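(* The Hochschild cohomology $HH^{-2}(A)$ has a $\mathbf{k}$-basis consisting of the classes of the following cocycles in $\mathrm{Hom}(V_2,A)$: (i) $A^{-2}$: $(x+y)x\mapsto x$, $xz\mapsto 0$, $zy\mapsto 0$; (ii) $B^{-2}(n_{2,p};m_{1,p})$: $(x+y)x\mapsto z^{m_1}\cdots z^{m_p}x$, $xz\mapsto 0$, $zy\mapsto 0$; where $p,n_2,\dots,n_p,m_1,\dots,m_p$ range over positive integers.
   Context: $\mathbf{k}$ is a field of characteristic $0$, $A=\mathbf{k}\langle x,y,z\rangle/(x^2+yx,\,xz,\,zy)$, $A^e=A\otimes A^{\mathrm{op}}$. Hochschild cohomology is placed in non-positive degrees: $HH^{-n}(A)=\mathrm{Ext}^n_{A^e}(A,A)$. The notation $n_{a,b}$ stands for the sequence $n_a,\dots,n_b$ (empty if $b<a$). The expression $z^{m_1}\cdots z^{m_p}$ is shorthand for $z^{m_1}xy^{n_2}z^{m_2}xy^{n_3}z^{m_3}\cdots xy^{n_p}z^{m_p}$ (for $p=1$ it is $z^{m_1}$). $A$ is Koszul, and $HH^\bullet(A)$ is computed by the cochain complex $0\to A\xrightarrow{d_1^*}\mathrm{Hom}(V_1,A)\xrightarrow{d_2^*}\mathrm{Hom}(V_2,A)\xrightarrow{d_3^*}\mathrm{Hom}(V_3,A)\xrightarrow{d_4^*}\mathrm{Hom}(V_4,A)\to 0$ obtained from the two-sided Koszul resolution, where $V_1=\mathbf{k}\{x,y,z\}$, $V_2=\mathbf{k}\{(x+y)x,xz,zy\}$, $V_3=\mathbf{k}\{(x+y)xz,xzy\}$,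 $V_4=\mathbf{k}\{(x+y)xzy\}$; for $f=(x\mapsto a,y\mapsto b,z\mapsto c)$, $d_2^*(f)$ is $(x+y)x\mapsto(x+y)a+ax+bx$, $xz\mapsto xc+az$, $zy\mapsto zb+cy$; for $f=((x+y)x\mapsto a,\,xz\mapsto b,\,zy\mapsto c)$, $d_3^*(f)$ is $(x+y)xz\mapsto(x+y)b-az$, $xzy\mapsto xc-by$. Thus $HH^{-2}(A)=\ker d_3^*/\mathrm{im}\,d_2^*$. *)

(* Defs.v *)
(* Ideal membership is decided classically (boolp), so that quotients can be formed. *)
From HB Require Import structures.
From mathcomp Require Import all_boot all_order all_algebra.
From mathcomp Require Import boolp finmap.
From mathcomp Require Import monalg.

Set Implicit Arguments.
Unset Strict Implicit.
Unset Printing Implicit Defensive.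

Import GRing.Theory.
Local Open Scope ring_scope.
Local Open Scope quotient_scope.

Section SubmoduleQuotient.
Variables (k : fieldType) (V : lmodType k) (U : submodClosed V).

Lemma submod_zmod_closed : zmod_closed U.
Proof.
by split=> [|u v uU vU]; rewrite ?rpred0 // -scaleN1r rpredD // rpredZ.
Qed.

Let Upred : V -> bool := GRing.SubmodClosed.sort U.

Definition submod_zmod : zmodClosed V := HB.pack Upred
  (GRing.isZmodClosed.Build V Upred submod_zmod_closed).

Definition lquot : Type := {ideal_quot submod_zmod}.

HB.instance Definition _ := GRing.Zmodule.on lquot.
HB.instance Definition _ := EqQuotient.on lquot.

Definition lproj (v : V) : lquot := \pi_lquot v.

Lemma lproj_eq u v : (lproj u == lproj v) = (u - v \in U).
Proof. by rewrite /lproj -Quotient.idealrBE. Qed.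

Lemma lproj_repr (q : lquot) : lproj (repr q) = q.
Proof. exact: reprK. Qed.

Lemma lproj_zmod_morphism : zmod_morphism lproj.
Proof. move=> u v; exact: (raddfB \pi_{ideal_quot submod_zmod}). Qed.

HB.instance Definition _ :=
  GRing.isZmodMorphism.Build V lquot lproj lproj_zmod_morphism.

Definition lquot_scale (a : k) := lift_op1 lquot ( *:%R a).

Lemma lproj_scale a v : lquot_scale a (lproj v) = lproj (a *: v).
Proof.
rewrite /lquot_scale; unlock; apply/eqP.
by rewrite lproj_eq -scalerBr rpredZ // -lproj_eq lproj_repr.
Qed.

Lemma lquot_scaleA a b q :
  lquot_scale a (lquot_scale b q) = lquot_scale (a * b) q.
Proof. by rewrite -[q]lproj_repr !lproj_scale scalerA. Qed.

Lemma lquot_scale1 : left_id 1 lquot_scale.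
Proof. by move=> q; rewrite -[q]lproj_repr lproj_scale scale1r. Qed.

Lemma lquot_scaleDr : right_distributive lquot_scale +%R.
Proof.
move=> a p q; rewrite -[p]lproj_repr -[q]lproj_repr -raddfD !lproj_scale.
by rewrite scalerDr raddfD.
Qed.

Lemma lquot_scaleDl q : {morph lquot_scale^~ q : a b / a + b}.
Proof.
by move=> a b; rewrite -[q]lproj_repr !lproj_scale scalerDl raddfD.
Qed.

HB.instance Definition _ := GRing.Zmodule_isLmodule.Build k lquot
  lquot_scaleA lquot_scale1 lquot_scaleDr lquot_scaleDl.

Lemma lprojZ : scalable lproj.
Proof. by move=> a v; rewrite -lproj_scale. Qed.

HB.instance Definition _ := GRing.isScalable.Build k V lquot *:%R lproj lprojZ.

End SubmoduleQuotient.

Section GeneratedIdeal.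
Variables (k : fieldType) (F : algType k) (rels : seq F).

(* The two-sided ideal generated by rels: finite sums of terms u * r * v. *)
Definition in_idealgen (w : F) : Prop :=
  exists2 s : seq (F * F * F),
    all (fun t => t.1.2 \in rels) s & w = \sum_(t <- s) t.1.1 * t.1.2 * t.2.

Definition idealgen : {pred F} := fun w => `[< in_idealgen w >].

Lemma idealgenP w : reflect (in_idealgen w) (w \in idealgen).
Proof. exact: asboolP. Qed.

Lemma idealgen_mull u w : w \in idealgen -> u * w \in idealgen.
Proof.
case/idealgenP=> s sR ->; apply/idealgenP.
exists [seq (u * t.1.1, t.1.2, t.2) | t <- s]; first by rewrite all_map.
by rewrite big_map mulr_sumr; apply: eq_bigr => t _; rewrite /= !mulrA.
Qed.

Lemma idealgen_mulr u w : w \in idealgen -> w * u \in idealgen.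
Proof.
case/idealgenP=> s sR ->; apply/idealgenP.
exists [seq (t.1.1, t.1.2, t.2 * u) | t <- s]; first by rewrite all_map.
by rewrite big_map mulr_suml; apply: eq_bigr => t _; rewrite /= !mulrA.
Qed.

Lemma idealgen_submod_closed : subsemimod_closed idealgen.
Proof.
split; first split=> [|u v /idealgenP[s sR ->] /idealgenP[t tR ->]].
- by apply/idealgenP; exists [::] => //; rewrite big_nil.
- by apply/idealgenP; exists (s ++ t); rewrite ?big_cat // all_cat sR.
by move=> a u uI; rewrite -mulr_algl idealgen_mull.
Qed.

HB.instance Definition _ :=
  GRing.isSubmodClosed.Build k F idealgen idealgen_submod_closed.

Lemma mem_idealgen r : r \in rels -> r \in idealgen.
Proof.
move=> rR; apply/idealgenP; exists [:: (1, r, 1)]; first by rewrite /= rR.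
by rewrite big_seq1 mul1r mulr1.
Qed.

Lemma idealgen_ker (S : pzRingType) (f : {rmorphism F -> S}) w :
  (forall r, r \in rels -> f r = 0) -> w \in idealgen -> f w = 0.
Proof.
move=> f0 /idealgenP[s sR ->]; rewrite rmorph_sum big_seq big1 //= => t ts.
by rewrite !rmorphM (f0 _ (allP sR _ ts)) mulr0 mul0r.
Qed.

End GeneratedIdeal.

(* The quotient algebra F / (rels); properness of the ideal is recorded because
   MathComp algebras are non-trivial rings. *)
Section QuotientAlgebra.
Variables (k : fieldType) (F : algType k) (rels : seq F).
Hypothesis proper_rels : 1 \notin idealgen rels.

Definition qalg of 1 \notin idealgen rels : Type := lquot (idealgen rels).
Local Notation Q := (qalg proper_rels).

HB.instance Definition _ := GRing.Lmodule.on Q.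
HB.instance Definition _ := EqQuotient.on Q.

Definition qproj : F -> Q := lproj (idealgen rels).
HB.instance Definition _ := GRing.Linear.on qproj.

Lemma qproj_eq u v : (qproj u == qproj v) = (u - v \in idealgen rels).
Proof. exact: lproj_eq. Qed.

Lemma qproj_repr (p : Q) : qproj (repr p) = p.
Proof. exact: lproj_repr. Qed.

Definition qone : Q := qproj 1.
Definition qmul := lift_op2 Q *%R.

Lemma qproj_mul u v : qmul (qproj u) (qproj v) = qproj (u * v).
Proof.
rewrite /qmul; unlock; apply/eqP; rewrite -[\pi_Q _]/(qproj _) qproj_eq.
set u' := repr _; set v' := repr _.
have uu' : u' - u \in idealgen rels by rewrite -qproj_eq qproj_repr.
have vv' : v' - v \in idealgen rels by rewrite -qproj_eq qproj_repr.
have -> : u' * v' - u * v = (u' - u) * v' + u * (v' - v).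
  by rewrite mulrBl mulrBr addrA subrK.
by apply: rpredD; [exact: idealgen_mulr | exact: idealgen_mull].
Qed.

Lemma qmulA : associative qmul.
Proof.
move=> p q r; rewrite -[p]qproj_repr -[q]qproj_repr -[r]qproj_repr.
by rewrite !qproj_mul mulrA.
Qed.

Lemma qmul1 : left_id qone qmul.
Proof. by move=> p; rewrite -[p]qproj_repr qproj_mul mul1r. Qed.

Lemma qmulr1 : right_id qone qmul.
Proof. by move=> p; rewrite -[p]qproj_repr qproj_mul mulr1. Qed.

Lemma qmulDl : left_distributive qmul +%R.
Proof.
move=> p q r; rewrite -[p]qproj_repr -[q]qproj_repr -[r]qproj_repr.
by rewrite -raddfD !qproj_mul mulrDl raddfD.
Qed.

Lemma qmulDr : right_distributive qmul +%R.
Proof.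
move=> p q r; rewrite -[p]qproj_repr -[q]qproj_repr -[r]qproj_repr.
by rewrite -raddfD !qproj_mul mulrDr raddfD.
Qed.

Lemma qone_neq0 : qone != 0.
Proof. by rewrite -(raddf0 qproj) qproj_eq subr0. Qed.

HB.instance Definition _ := GRing.Zmodule_isNzRing.Build Q
  qmulA qmul1 qmulr1 qmulDl qmulDr qone_neq0.

Lemma qproj_monoid_morphism : monoid_morphism qproj.
Proof. by split=> // u v; rewrite -qproj_mul. Qed.

HB.instance Definition _ :=
  GRing.isMonoidMorphism.Build F Q qproj qproj_monoid_morphism.

Lemma qscaleAl (a : k) (p q : Q) : a *: (p * q) = (a *: p) * q.
Proof.
rewrite -[p]qproj_repr -[q]qproj_repr -rmorphM -!linearZ -rmorphM /=.
by rewrite scalerAl.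
Qed.

HB.instance Definition _ := GRing.Lmodule_isLalgebra.Build k Q qscaleAl.

Lemma qscaleAr (a : k) (p q : Q) : a *: (p * q) = p * (a *: q).
Proof.
rewrite -[p]qproj_repr -[q]qproj_repr -rmorphM -!linearZ -rmorphM /=.
by rewrite scalerAr.
Qed.

HB.instance Definition _ := GRing.Lalgebra_isAlgebra.Build k Q qscaleAr.

Lemma qproj_rel r : r \in rels -> qproj r = 0.
Proof.
by move=> rR; apply/eqP; rewrite -(raddf0 qproj) qproj_eq subr0 mem_idealgen.
Qed.

End QuotientAlgebra.

Section Basis.
Variables (k : fieldType) (V : lmodType k) (I : eqType) (e : I -> V).

Definition lin_indep : Prop := forall (s : seq I) (c : I -> k),
  uniq s -> \sum_(i <- s) c i *: e i = 0 -> forall i, i \in s -> c i = 0.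

Definition spanning : Prop := forall v : V,
  exists (s : seq I) (c : I -> k), v = \sum_(i <- s) c i *: e i.

Definition is_basis : Prop := lin_indep /\ spanning.

End Basis.

Lemma malg_scaleAr (K : monomType) (R : comNzRingType) (a : R)
  (u v : {malg R[K]}) : a *: (u * v) = u * (a *: v).
Proof.
apply/malgP=> m; rewrite mcoeffZ [in LHS]mcoeffMl.
rewrite (mcoeffMlw _ (fsubset_refl _) (msuppZ_le a v)) mulr_sumr.
apply: eq_bigr => m1 _; rewrite mulr_sumr; apply: eq_bigr => m2 _.
by rewrite mcoeffZ mulrCA mulrnAr.
Qed.

Section FreeAlgebra.
Variables (k : fieldType) (I : choiceType).

(* k<I>: the monoid algebra of the free monoid on I. *)
Definition freealg : Type := {malg k[{fmonom I}]}.
HB.instance Definition _ := GRing.Lalgebra.on freealg.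
HB.instance Definition _ :=
  GRing.Lalgebra_isAlgebra.Build k freealg (@malg_scaleAr _ _).

Definition letter (i : I) : freealg := mkmalgU (fmu i) 1.

(* The constant coefficient. *)
Definition augm : freealg -> k := mcoeff (mone : {fmonom I}).
HB.instance Definition _ := GRing.RMorphism.on augm.

Lemma augm_letter i : augm (letter i) = 0.
Proof. by rewrite /augm mcoeffU fm1_eq1. Qed.

End FreeAlgebra.

Section Relators.
Variables (k : fieldType) (F : algType k) (X Y Z : F).

Definition relators : seq F := [:: X ^+ 2 + Y * X; X * Z; Z * Y].

Lemma relators_proper (S : nzRingType) (f : {rmorphism F -> S}) :
  f X = 0 -> f Y = 0 -> f Z = 0 -> 1 \notin idealgen relators.
Proof.
move=> fX fY fZ; apply/negP=> I1; have /eqP := oner_neq0 S; apply.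
rewrite -(rmorph1 f); apply: idealgen_ker I1 => r.
by rewrite !inE => /or3P[] /eqP->;
  rewrite ?rmorphD ?rmorphXn !rmorphM /= ?fX ?fY ?fZ ?(mulr0, expr0n, addr0).
Qed.

Lemma relator_xx : X ^+ 2 + Y * X \in relators.
Proof. by rewrite !inE eqxx. Qed.

Lemma relator_xz : X * Z \in relators.
Proof. by rewrite !inE eqxx orbT. Qed.

Lemma relator_zy : Z * Y \in relators.
Proof. by rewrite !inE eqxx !orbT. Qed.

End Relators.

Section Algebra.
Variable k : fieldType.
Local Notation F := (freealg k 'I_3).

Definition X : F := letter k (@Ordinal 3 0 isT).
Definition Y : F := letter k (@Ordinal 3 1 isT).
Definition Z : F := letter k (@Ordinal 3 2 isT).

Lemma relatorsA_proper : 1 \notin idealgen (relators X Y Z).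
Proof.
exact: (relators_proper (augm_letter _ _) (augm_letter _ _) (augm_letter _ _)).
Qed.

Definition A : Type := qalg relatorsA_proper.
HB.instance Definition _ := GRing.Algebra.on A.

Definition Ax : A := qproj relatorsA_proper X.
Definition Ay : A := qproj relatorsA_proper Y.
Definition Az : A := qproj relatorsA_proper Z.

Lemma Axx : Ax ^+ 2 + Ay * Ax = 0.
Proof.
by rewrite /Ax /Ay -rmorphXn -rmorphM -raddfD /= qproj_rel // relator_xx.
Qed.

Lemma Axz : Ax * Az = 0.
Proof. by rewrite /Ax /Az -rmorphM /= qproj_rel // relator_xz. Qed.

Lemma Azy : Az * Ay = 0.
Proof. by rewrite /Az /Ay -rmorphM /= qproj_rel // relator_zy. Qed.

End Algebra.

(* Degrees 1, 2, 3 of the complex Hom(V_i, A). A linear map out of V_i is the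
   tuple of its values on the basis of V_i, taken in the order
   x, y, z for V_1; (x+y)x, xz, zy for V_2; (x+y)xz, xzy for V_3. *)
Section Koszul.
Variables (k : fieldType) (A : algType k) (x y z : A).

Definition d2 (f : A * A * A) : A * A * A :=
  let: (a, b, c) := f in
  ((x + y) * a + a * x + b * x, x * c + a * z, z * b + c * y).

Definition d3 (f : A * A * A) : A * A :=
  let: (a, b, c) := f in ((x + y) * b - a * z, x * c - b * y).

Lemma d2_linear : linear d2.
Proof.
move=> t [[a b] c] [[a' b'] c'] /=; congr (_, _, _) => /=; last 2 first.
- by rewrite mulrDr mulrDl -scalerAr -scalerAl addrACA -scalerDr.
- by rewrite mulrDr mulrDl -scalerAr -scalerAl addrACA -scalerDr.
rewrite [(x + y) * (_ + _)]mulrDr [_ * x]mulrDl [(_ + b') * x]mulrDl.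
rewrite -scalerAr -!scalerAl [X in X + _ = _]addrACA.
by rewrite [LHS]addrACA -!scalerDr.
Qed.

HB.instance Definition _ :=
  GRing.isLinear.Build k (A * A * A)%type (A * A * A)%type *:%R d2 d2_linear.

Lemma d3_linear : linear d3.
Proof.
move=> t [[a b] c] [[a' b'] c'] /=; congr (_, _) => /=.
  rewrite [(x + y) * _]mulrDr [_ * z]mulrDl -scalerAr -scalerAl opprD.
  by rewrite addrACA -scalerN -scalerDr.
rewrite mulrDr mulrDl -scalerAr -scalerAl opprD.
by rewrite addrACA -scalerN -scalerDr.
Qed.

HB.instance Definition _ :=
  GRing.isLinear.Build k (A * A * A)%type (A * A)%type *:%R d3 d3_linear.

Lemma d3_d2 f : x ^+ 2 + y * x = 0 -> x * z = 0 -> z * y = 0 -> d3 (d2 f) = 0.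
Proof.
case: f => [[a b] c] xx0 xz0 zy0; congr (_, _) => /=.
  rewrite [_ * (_ + _)]mulrDr !mulrA [in X in X * c + _]mulrDl -expr2 xx0.
  by rewrite mul0r add0r 2![(_ + _) * z]mulrDl -!mulrA xz0 !mulr0 !addr0 subrr.
by rewrite mulrDr mulrDl !mulrA xz0 -[a * z * y]mulrA zy0 mul0r mulr0
  add0r addr0 subrr.
Qed.

Definition cocycle : {pred A * A * A} := fun f => d3 f == 0.

Lemma cocycle_submod_closed : subsemimod_closed cocycle.
Proof.
split; first split=> [|f g /eqP f0 /eqP g0].
- by rewrite unfold_in /cocycle raddf0.
- by rewrite unfold_in /cocycle raddfD /= f0 g0 addr0.
by move=> t f /eqP f0; rewrite unfold_in /cocycle linearZ /= f0 scaler0.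
Qed.

HB.instance Definition _ :=
  GRing.isSubmodClosed.Build k (A * A * A)%type cocycle cocycle_submod_closed.

Definition cocycles : Type := {f : A * A * A | f \in cocycle}.
HB.instance Definition _ := SubChoice.on cocycles.
HB.instance Definition _ := [SubChoice_isSubLmodule of cocycles by <:].

Definition coboundary : {pred cocycles} :=
  fun f => `[< exists g, val f = d2 g >].

Lemma coboundary_submod_closed : subsemimod_closed coboundary.
Proof.
split; first split=> [|f g /asboolP[f' ff'] /asboolP[g' gg']].
- by apply/asboolP; exists 0; rewrite !raddf0.
- by apply/asboolP; exists (f' + g'); rewrite !raddfD /= ff' gg'.
by move=> t f /asboolP[f' ff']; apply/asboolP; exists (t *: f');
  rewrite !linearZ /= ff'.
Qed.

HB.instance Definition _ :=
  GRing.isSubmodClosed.Build k cocycles coboundary coboundary_submod_closed.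

Definition cohomology : Type := lquot coboundary.
HB.instance Definition _ := GRing.Lmodule.on cohomology.

Definition cclass : cocycles -> cohomology := lproj coboundary.
HB.instance Definition _ := GRing.Linear.on cclass.

(* z^m_1 x y^n_2 z^m_2 ... x y^n_p z^m_p for ns = [n_2; ...; n_p] and
   ms = [m_1; ...; m_p]. *)
Definition zword (ns ms : seq nat) : A :=
  z ^+ head 0%N ms *
  \prod_(nm <- zip ns (behead ms)) (x * y ^+ nm.1 * z ^+ nm.2).

End Koszul.

Definition Z2 (k : fieldType) : Type := cocycles (Ax k) (Ay k) (Az k).
HB.instance Definition _ (k : fieldType) :=
  GRing.SubLmodule.on (Z2 k).

(* HH^{-2}(A) = ker d_3^* / im d_2^*. *)
Definition HH2 (k : fieldType) : Type := cohomology (Ax k) (Ay k) (Az k).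
HB.instance Definition _ (k : fieldType) := GRing.Lmodule.on (HH2 k).

Definition HH2_class (k : fieldType) : Z2 k -> HH2 k :=
  @cclass k (A k) (Ax k) (Ay k) (Az k).
HB.instance Definition _ (k : fieldType) := GRing.Linear.on (@HH2_class k).

(* Pairs ([n_2; ...; n_p], [m_1; ...; m_p]) of lists of positive integers, with
   p >= 1. *)
Definition Bindex : Type := {nm : seq nat * seq nat |
  [&& size nm.2 == (size nm.1).+1, all (ltn 0) nm.1 & all (ltn 0) nm.2]}.
HB.instance Definition _ := Equality.on Bindex.

(* None is A^{-2}, Some (ns, ms) is B^{-2}(ns; ms). *)
Definition HH2_rep (k : fieldType) (i : option Bindex) : A k * A k * A k :=
  if i is Some nm
  then (zword (Ax k) (Ay k) (Az k) (val nm).1 (val nm).2 * Ax k, 0, 0)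
  else (Ax k, 0, 0).

(* Main.v *)
(* Put u = x + y. In the generators x, u, z the relations become the monomial
   ones ux = 0, xz = 0, zu = zx, so A has a basis of normal words, those that
   avoid ux, xz, zu, zxx, and left multiplication by x, u or z maps a normal word
   to a normal word or to 0. Reading off coefficients in ub = az and xc = by shows that every
   cocycle (a, b, c) is cohomologous to some (b'x, 0, 0). Such a cocycle is a
   coboundary when b' lies in xA + yA + Ax, and modulo these b' can be taken in
   the span of 1 and of the normal words that start and end with z; the latter
   are the z^m_1 x u^n_2 z^m_2 ... = z^m_1 x y^n_2 z^m_2 .... Conversely, the
   coefficients of b' at these words vanish when (b'x, 0, 0) is a coboundary. *)
Require Import Defs.
From HB Require Import structures.
From mathcomp Require Import all_boot all_order all_algebra.
From mathcomp Require Import boolp functions finmap.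
From mathcomp Require Import monalg.

Set Implicit Arguments.
Unset Strict Implicit.
Unset Printing Implicit Defensive.

Import GRing.Theory.
Local Open Scope ring_scope.

(** * Induction on elements of the free algebra *)

Lemma freealg_ind (k : fieldType) (I : choiceType) (P : freealg k I -> Prop) :
  (forall a b, P a -> P b -> P (a + b)) ->
  (forall c a, P a -> P (c *: a)) ->
  P 1 -> (forall i a, P a -> P (letter k i * a)) -> forall a, P a.
Proof.
move=> PD PZ P1 PM a.
have P0 : P 0 by rewrite -(scale0r (1 : freealg k I)); apply: PZ.
rewrite [a]monalgE; elim/big_ind: _ => // m _.
have -> : << a@_m *g m >> = a@_m *: (<< 1 *g m >> : freealg k I).
  by apply/malgP=> m'; rewrite mcoeffZ !mcoeffU mulrnAr mulr1.
apply: PZ; case: m => s; elim: s => [|i s IH]; first by rewrite -fmoneE.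
have -> : << 1 *g FMonom (i :: s) >> = letter k i * << 1 *g FMonom s >>.
  by rewrite malgM_def fgmulUU mulr1; congr << _ *g _ >>; apply/eqP; rewrite fmP /= fmM fmU.
exact: PM.
Qed.

(** * Words in x, u, z and their normal forms *)

Inductive gen := gx | gu | gz.

Definition gen_eqb (g h : gen) :=
  match g, h with gx, gx | gu, gu | gz, gz => true | _, _ => false end.

Lemma gen_eqbP : eq_axiom gen_eqb.
Proof. by case; case; constructor. Qed.

HB.instance Definition _ := hasDecEq.Build gen gen_eqbP.

Notation word := (seq gen).

(* [gu] stands for u = x + y; [None] is the product 0. *)
Definition lmulw (g : gen) (w : word) : option word :=
  match g, w with
  | gu, gx :: _ | gx, gz :: _ => None
  | gz, gu :: (gx | gz) :: _ | gz, gx :: (gx | gz) :: _ => None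
  | gz, gu :: w' => Some [:: gz, gx & w']
  | _, _ => Some (g :: w)
  end.

(** Equivalently, the words without ux, xz, zu or zxx as a subword. *)
Fixpoint normal (w : word) : bool :=
  if w is g :: w' then (lmulw g w' == Some (g :: w')) && normal w' else true.

Lemma lmulw_normal g w w' : normal w -> lmulw g w = Some w' -> normal w'.
Proof.
case: g; case: w => [|[] [|[] w]] //= nw [<-] //=;
  by case/andP: nw => nw1 ->; rewrite ?nw1 ?eqxx; move: nw1; case: w => [|[]].
Qed.

(** * Functionals on A that evaluate functions on words *)

Section Pairing.
Variable k : fieldType.
Local Notation F := (freealg k 'I_3).
Implicit Types (phi psi : word -> k) (v w : word).

(* Right action of the generators on functions on words, dual to [lmulw]. *)
Definition act g phi : word -> k := fun w => oapp phi 0 (lmulw g w).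

Definition act_letter (i : 'I_3) phi : word -> k :=
  if val i == 0%N then act gx phi
  else if val i == 1%N then act gu phi - act gx phi else act gz phi.

(** Letters act on the span of all words through [lmulw], with y acting as u - x. This is [phi] at
    the result of a acting on the empty word, the letters being moved onto [phi] one by one. *)
Definition pairF phi (a : F) : k :=
  mmap idfun (fun m : {fmonom 'I_3} => foldl (fun p i => act_letter i p) phi m [::]) a.

Lemma pairF_is_linear phi : linear_for *%R (pairF phi).
Proof.
move=> c a b; rewrite /pairF mmapD; congr (_ + _).
rewrite (mmapEw (msuppZ_le _ _)) mmapE big_distrr /=.
by apply/eq_bigr => m _; rewrite mcoeffZ mulrA.
Qed.

HB.instance Definition _ phi :=
  GRing.isLinear.Build k F k *%R (pairF phi) (pairF_is_linear phi).

Lemma pairF_letter phi i a : pairF phi (letter k i * a) = pairF (act_letter i phi) a.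
Proof.
rewrite [a]monalgE mulr_sumr !raddf_sum; apply: eq_bigr => m _.
by rewrite /letter malgM_def fgmulUU /= /pairF !mmapU mul1r /= fmM fmU.
Qed.

Lemma pairF1 phi : pairF phi 1 = phi [::].
Proof. by rewrite /pairF [mmap _ _ _]mmapU mul1r fm1. Qed.

Lemma actB g : {morph act g : phi psi / phi - psi}.
Proof.
by move=> phi psi; apply/funext => w; rewrite /act /= !fctE; case: lmulw => //=; rewrite subr0.
Qed.

Lemma act_letterB i : {morph act_letter i : phi psi / phi - psi}.
Proof.
move=> phi psi; rewrite /act_letter; case: ifP => _; rewrite ?actB //.
by case: ifP => _; rewrite ?actB // opprB addrACA [X in _ + X]addrC opprB addrACA.
Qed.

Lemma pairFB a : {morph pairF^~ a : phi psi / phi - psi}.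
Proof.
elim/freealg_ind: a => [a b IHa IHb|c a IHa||i a IHa] phi psi.
- by rewrite !linearD /= IHa IHb opprD addrACA.
- by rewrite !linearZ /= IHa mulrBr.
- by rewrite !pairF1.
- by rewrite !pairF_letter act_letterB IHa.
Qed.

Lemma pairFX phi a : pairF phi (X k * a) = pairF (act gx phi) a.
Proof. by rewrite pairF_letter. Qed.

Lemma pairFY phi a :
  pairF phi (Y k * a) = pairF (act gu phi) a - pairF (act gx phi) a.
Proof. by rewrite pairF_letter -pairFB. Qed.

Lemma pairFZ phi a : pairF phi (Z k * a) = pairF (act gz phi) a.
Proof. by rewrite pairF_letter. Qed.

Lemma pairF0 a : pairF 0 a = 0.
Proof. by have := pairFB a 0 0; rewrite !subrr. Qed.

(** The relations ux = 0, xz = 0 and zu = zx hold for the action on all words, normal or not; for zu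
    = zx this is what the two-letter cases of [lmulw] secure. *)
Lemma act_ux phi : act gx (act gu phi) = 0.
Proof. by apply/funext => -[|[] w]. Qed.

Lemma act_xz phi : act gz (act gx phi) = 0.
Proof. by apply/funext => -[|[] [|[] w]]. Qed.

Lemma act_zu phi : act gu (act gz phi) = act gx (act gz phi).
Proof. by apply/funext => -[|[] [|[] w]]. Qed.

(** Induction on the left factor moves its letters onto [phi], which therefore has to vary; what is
    left is a relator times b. *)
Lemma pairF_ideal phi a : a \in idealgen (relators (X k) (Y k) (Z k)) -> pairF phi a = 0.
Proof.
case/idealgenP=> s sR ->; rewrite raddf_sum big_seq big1 //= => -[[a' r] b] ts.
move/(allP sR): ts => /= {s sR a} rR; rewrite -mulrA.
elim/freealg_ind: a' phi => [a a' IHa IHa'|c a IHa||i a IHa] phi.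
- set w := r * b in IHa IHa' *.
  rewrite (mulrDl a a' w) raddfD.
  exact: etrans (congr2 +%R (IHa phi) (IHa' phi)) (addr0 0).
- by rewrite -(scalerAl c a (r * b)) linearZ /= IHa mulr0.
- rewrite mul1r; move: rR; rewrite !inE => /or3P[] /eqP-> {r}.
  (* The relator is ux: the two terms with [act gx phi] cancel and [act gx (act gu phi)] remains. *)
  + have E (R : pzRingType) (x y c : R) :
        (x ^+ 2 + y * x) * c = x * (x * c) + y * (x * c).
      by rewrite mulrDl expr2 !mulrA.
    rewrite (E _ (X k) (Y k) b) raddfD.
    apply: etrans (congr2 +%R (pairFX _ _) (pairFY _ _)) _.
    by rewrite !pairFX act_ux pairF0 sub0r subrr.
  + by rewrite -(mulrA (X k) (Z k) b) pairFX pairFZ act_xz pairF0.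
  + by rewrite -(mulrA (Z k) (Y k) b) pairFZ pairFY act_zu subrr.
- by rewrite -(mulrA (letter k i) a (r * b)) pairF_letter IHa.
Qed.

Definition pair phi (a : A k) : k := pairF phi (repr a).

Lemma pairE phi a : pair phi (qproj _ a) = pairF phi a.
Proof.
apply/eqP; rewrite -subr_eq0 -raddfB; apply/eqP/pairF_ideal.
by rewrite -(qproj_eq (relatorsA_proper k)) qproj_repr.
Qed.

Lemma pair_is_linear phi : linear_for *%R (pair phi).
Proof.
move=> c a b; rewrite -[a]qproj_repr -[b]qproj_repr -linearZ -linearD !pairE.
by rewrite linearD linearZ.
Qed.

HB.instance Definition _ phi :=
  GRing.isLinear.Build k (A k) k *%R (pair phi) (pair_is_linear phi).

Lemma pair_mulX phi a : pair phi (Ax k * a) = pair (act gx phi) a.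
Proof.
rewrite -[a]qproj_repr; set b : F := repr a.
by rewrite /Ax -(rmorphM (qproj (relatorsA_proper k)) (X k) b) !pairE pairFX.
Qed.

Lemma pair_mulY phi a :
  pair phi (Ay k * a) = pair (act gu phi) a - pair (act gx phi) a.
Proof.
rewrite -[a]qproj_repr; set b : F := repr a.
by rewrite /Ay -(rmorphM (qproj (relatorsA_proper k)) (Y k) b) !pairE pairFY.
Qed.

Lemma pair_mulZ phi a : pair phi (Az k * a) = pair (act gz phi) a.
Proof.
rewrite -[a]qproj_repr; set b : F := repr a.
by rewrite /Az -(rmorphM (qproj (relatorsA_proper k)) (Z k) b) !pairE pairFZ.
Qed.

Lemma pair1 phi : pair phi 1 = phi [::].
Proof. by rewrite -(rmorph1 (qproj (relatorsA_proper k))) pairE pairF1. Qed.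

Lemma A_ind (P : A k -> Prop) :
  (forall a b, P a -> P b -> P (a + b)) -> (forall c a, P a -> P (c *: a)) ->
  P 1 -> (forall a, P a -> P (Ax k * a)) -> (forall a, P a -> P (Ay k * a)) ->
  (forall a, P a -> P (Az k * a)) -> forall a, P a.
Proof.
move=> PD PZ P1 Px Py Pz a; rewrite -[a]qproj_repr.
elim/freealg_ind: (repr a) => [b c Pb Pc|c b Pb||i b Pb].
- by rewrite raddfD; apply: PD.
- by rewrite linearZ; apply: PZ.
- by rewrite rmorph1.
- rewrite rmorphM; case: i => -[|[|[|//]]] i3; rewrite (bool_irrelevance i3 isT).
  + exact: Px.
  + exact: Py.
  + exact: Pz.
Qed.

End Pairing.

(** * Normal words extended on the right *)

Lemma normal_rcons_z w : normal w -> last gz w != gx -> normal (rcons w gz).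
Proof.
elim: w => //= g w IH /andP[ng nw] nx.
have {}IH : normal (rcons w gz).
  by apply: IH => //; case: w nx {ng nw} => //=.
by rewrite IH andbT; move: ng nx; case: g; case: w {nw IH} => [|[] [|[] w]] //=; rewrite eqxx.
Qed.

(** The forbidden subwords ending in x are ux and zxx; neither arises after a final z. *)
Lemma normal_rcons_x w : normal w -> last gz w = gz -> normal (rcons w gx).
Proof.
elim: w => //= g w IH /andP[ng nw] lw.
have {}IH : normal (rcons w gx).
  by apply: IH => //; case: w lw {ng nw} => //=.
by rewrite IH andbT; move: ng lw; case: g; case: w {nw IH} => [|[] [|[] w]] //=; rewrite eqxx.
Qed.

(** * Normal words as a basis, and the cocycle equations read off on coefficients *)

Section Words.
Variables (k : fieldType) (B : algType k) (x y z : B).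
Hypotheses (xx : x ^+ 2 + y * x = 0) (xz : x * z = 0) (zy : z * y = 0).
Implicit Types (v w : word) (a b c : B).

Definition letterA (g : gen) : B :=
  match g with gx => x | gu => x + y | gz => z end.

Definition wordA w : B := \prod_(g <- w) letterA g.

Lemma wordA_cons g w : wordA (g :: w) = letterA g * wordA w.
Proof. by rewrite /wordA big_cons. Qed.

Lemma wordA_cat v w : wordA (v ++ w) = wordA v * wordA w.
Proof. by rewrite /wordA big_cat. Qed.

Lemma wordA_rcons w g : wordA (rcons w g) = wordA w * letterA g.
Proof. by rewrite -cats1 wordA_cat /wordA big_seq1. Qed.

Lemma ux : (x + y) * x = 0.
Proof. by rewrite mulrDl -expr2. Qed.

Lemma zu : z * (x + y) = z * x.
Proof. by rewrite mulrDr zy addr0. Qed.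

(** The overlap zux of zu = zx and ux = 0. *)
Lemma zxx : z * x * x = 0.
Proof. by rewrite -zu -mulrA ux mulr0. Qed.

Lemma letterA_wordA g w : letterA g * wordA w = oapp wordA 0 (lmulw g w).
Proof.
have uxA a : (x + y) * (x * a) = 0 by rewrite mulrA ux mul0r.
have xzA a : x * (z * a) = 0 by rewrite mulrA xz mul0r.
have zuA a : z * ((x + y) * a) = z * (x * a) by rewrite !mulrA zu.
have zxxA a : z * (x * (x * a)) = 0 by rewrite !mulrA zxx mul0r.
by case: g; case: w => [|[] [|[] w]]; rewrite /= ?wordA_cons /= ?(uxA, xzA, zuA, zxxA, mulr0).
Qed.

(** The third case is there because zu becomes zx; the default [gx] of [last] keeps the empty word
    out of it. *)
Lemma wordA_mul_letter w g : normal w ->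
  [\/ wordA w * letterA g = 0, normal (rcons w g) |
      g = gu /\ last gx w = gz].
Proof.
elim: w => [|h w IH] /=; first by case: g; constructor 2.
case/andP=> nh nw; rewrite wordA_cons -mulrA.
case: {IH}(IH nw) => [->|nwg|[-> lw]].
- by rewrite mulr0; constructor 1.
- rewrite -wordA_rcons letterA_wordA nwg andbT.
  move: nh nwg; case: h; case: w {nw} => [|[] [|[] w]] //=; case: g => //= _ _;
    by [constructor 1 | constructor 2; rewrite eqxx | constructor 3].
- by constructor 3; split => //; case: w lw {nh nw}.
Qed.

(** What is used of A besides its relations: the letters generate it, and every function on words
    gives a functional compatible with [act]. *)
Hypothesis B_ind : forall P : B -> Prop,
  (forall a b, P a -> P b -> P (a + b)) -> (forall t a, P a -> P (t *: a)) ->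
  P 1 -> (forall g a, P a -> P (letterA g * a)) -> forall a, P a.
Variable pairing : (word -> k) -> {scalar B}.
Hypothesis pairing1 : forall phi, pairing phi 1 = phi [::].
Hypothesis pairing_letter : forall phi g a,
  pairing phi (letterA g * a) = pairing (act g phi) a.

(** The pairing is not assumed linear in [phi], so the zero function takes an induction on a. *)
Lemma pairing0 phi a : phi =1 (fun=> 0) -> pairing phi a = 0.
Proof.
elim/B_ind: a phi => [a b IHa IHb|t a IHa||g a IHa] phi phi0.
- by rewrite raddfD /= IHa ?IHb ?addr0.
- by rewrite linearZ /= IHa ?mulr0.
- by rewrite pairing1 phi0.
- by rewrite pairing_letter IHa // => w; rewrite /act; case: lmulw.
Qed.

Lemma pairing_wordA phi w : normal w -> pairing phi (wordA w) = phi w.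
Proof.
elim: w phi => [|g w IH] phi /=; first by rewrite /wordA big_nil pairing1.
by case/andP=> /eqP ng nw; rewrite wordA_cons pairing_letter IH // /act ng.
Qed.

Definition coef v : {scalar B} := pairing (fun w => (w == v)%:R).

Lemma coef_wordA v w : normal w -> coef v (wordA w) = (w == v)%:R.
Proof. exact: pairing_wordA. Qed.

Lemma normal_span a : exists2 s : seq (k * word),
  all (fun t => normal t.2) s & a = \sum_(t <- s) t.1 *: wordA t.2.
Proof.
elim/B_ind: a => [a b [s ns ->] [s' ns' ->]|t a [s ns ->]||g a [s ns ->]].
- by exists (s ++ s'); rewrite ?all_cat ?ns // big_cat.
- exists [seq (t * p.1, p.2) | p <- s]; first by rewrite all_map.
  by rewrite big_map scaler_sumr; apply: eq_bigr => p _; rewrite scalerA.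
- by exists [:: (1, [::])] => //; rewrite big_seq1 /wordA big_nil scale1r.
- elim: s ns => [_|[t w] s IH /= /andP[nw /IH[s' ns' Es']]].
    by exists [::]; rewrite ?big_nil ?mulr0.
  case E: (lmulw g w) => [w'|].
    exists ((t, w') :: s'); first by rewrite /= (lmulw_normal nw E).
    by rewrite !big_cons mulrDr Es' -scalerAr letterA_wordA E.
  exists s' => //.
  by rewrite big_cons mulrDr Es' -scalerAr letterA_wordA E scaler0 add0r.
Qed.

(** As a is the sum of its coefficients times normal words, membership in a subspace need only be
    checked on the words that occur in a. *)
Lemma coef_ind (P : B -> Prop) a :
  P 0 -> (forall b c, P b -> P c -> P (b + c)) -> (forall t b, P b -> P (t *: b)) ->
  (forall v, normal v -> coef v a != 0 -> P (wordA v)) -> P a.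
Proof.
move=> P0 PD PZ Pw; have [s ns Ea] := normal_span a.
(* The spanning words may repeat; once duplicates are removed, [coef] gives the coefficients. *)
have {Ea} -> : a = \sum_(v <- undup [seq t.2 | t <- s]) coef v a *: wordA v.
  rewrite [in LHS]Ea [in RHS]Ea; under [RHS]eq_bigr do rewrite linear_sum scaler_suml.
  rewrite exchange_big big_seq [RHS]big_seq; apply: eq_bigr => t ts.
  have st : t.2 \in undup [seq t.2 | t <- s] by rewrite mem_undup map_f.
  rewrite (bigD1_seq t.2) ?undup_uniq //= linearZ /= coef_wordA ?(allP ns) //.
  rewrite eqxx mulr1 big1 ?addr0 // => v /negPf vt.
  by rewrite linearZ /= coef_wordA ?(allP ns) // eq_sym vt mulr0 scale0r.
rewrite big_seq; elim/big_ind: _ => // v.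
rewrite mem_undup => /mapP[t ts ->].
have [->|cv] := eqVneq (coef t.2 a) 0; first by rewrite scale0r.
by apply/PZ/Pw => //; apply: (allP ns).
Qed.

Lemma normal_ind (P : B -> Prop) :
  P 0 -> (forall b c, P b -> P c -> P (b + c)) -> (forall t b, P b -> P (t *: b)) ->
  (forall w, normal w -> P (wordA w)) -> forall a, P a.
Proof. by move=> P0 PD PZ Pw a; apply: coef_ind => // v nv _; apply: Pw. Qed.

(** Right multiplication by g kills or extends each normal word, and extension is injective; v is
    not killed because the normal word vg is nonzero. *)
Lemma coef_mulr g v a :
  (forall w, normal w -> wordA w * letterA g = 0 \/ normal (rcons w g)) ->
  normal (rcons v g) -> coef (rcons v g) (a * letterA g) = coef v a.
Proof.
move=> mulg nv; elim/normal_ind: a => [|b c IHb IHc|t b IH|w nw].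
- by rewrite mul0r !raddf0.
- by rewrite mulrDl !raddfD /= IHb IHc.
- by rewrite -scalerAl !linearZ /= IH.
rewrite [in RHS]coef_wordA //; case: (mulg w nw) => [w0|nwg].
  rewrite w0 raddf0; case: eqP => // wv; move: w0; rewrite wv -wordA_rcons => w0.
  have := coef_wordA (rcons v g) nv; rewrite w0 raddf0 eqxx => /eqP.
  by rewrite eq_sym oner_eq0.
by rewrite -wordA_rcons coef_wordA // eqseq_rcons eqxx andbT.
Qed.

Lemma coef_mulr_x v a : normal (rcons v gx) -> coef (rcons v gx) (a * x) = coef v a.
Proof. by move=> nv; apply: (@coef_mulr gx) => // w /(wordA_mul_letter gx)[]; auto; case. Qed.

Lemma coef_mulr_z v a : normal (rcons v gz) -> coef (rcons v gz) (a * z) = coef v a.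
Proof. by move=> nv; apply: (@coef_mulr gz) => // w /(wordA_mul_letter gz)[]; auto; case. Qed.

(** With y = u - x, the products wu and wx are 0 or normal words ending in u or x, except wu when w
    ends in z; then wu = wx. *)
Lemma coef_rcons_z_mul_y v a : coef (rcons v gz) (a * y) = 0.
Proof.
have -> : y = (x + y) - x by rewrite addrAC subrr add0r.
elim/normal_ind: a => [|b c IHb IHc|t b IH|w nw].
- by rewrite mul0r raddf0.
- by rewrite mulrDl raddfD /= IHb IHc addr0.
- by rewrite -scalerAl linearZ /= IH mulr0.
have wx : coef (rcons v gz) (wordA w * letterA gx) = 0.
  case: (wordA_mul_letter gx nw) => [->|nwx|[]] //; first by rewrite raddf0.
  by rewrite -wordA_rcons coef_wordA // eqseq_rcons andbF.
rewrite mulrBr raddfB /= [X in _ - X]wx subr0 -[x + y]/(letterA gu).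
case: (wordA_mul_letter gu nw) => [->|nwu|[_]]; first by rewrite raddf0.
  by rewrite -wordA_rcons coef_wordA // eqseq_rcons andbF.
case/lastP: w nw wx => // w g _; rewrite last_rcons => wx gE.
by move: wx; rewrite gE wordA_rcons -!mulrA /= zu.
Qed.

Lemma coef_mul_u v a : head gz v != gx -> coef (gu :: v) ((x + y) * a) = coef v a.
Proof.
rewrite /coef -[x + y]/(letterA gu) pairing_letter => hv; congr (pairing _ a).
by apply/funext => w; rewrite /act; case: w => [|[] w] //=; case: v hv => [|[] v].
Qed.

Lemma coef_mul_u0 v a : head gz v != gu -> coef v ((x + y) * a) = 0.
Proof.
rewrite /coef -[x + y]/(letterA gu) pairing_letter => hv; apply: pairing0.
by move=> w; rewrite /act; case: w => [|[] w] //=; case: v hv => [|[] v].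
Qed.

Lemma coef_mul_x v a : head gx v != gz -> coef (gx :: v) (x * a) = coef v a.
Proof.
rewrite /coef -[x in x * _]/(letterA gx) pairing_letter => hv; congr (pairing _ a).
by apply/funext => w; rewrite /act; case: w => [|[] w] //=; case: v hv => [|[] v].
Qed.

Lemma coef_mul_x0 v a : head gz v != gx -> coef v (x * a) = 0.
Proof.
rewrite /coef -[x in x * _]/(letterA gx) pairing_letter => hv; apply: pairing0.
by move=> w; rewrite /act; case: w => [|[] w] //=; case: v hv => [|[] v].
Qed.

(** Rewriting zu to zx only produces words starting with zx, so for v empty or starting with z, only
    v itself is sent to zv. *)
Lemma coef_mul_z v a : head gz v = gz -> coef (gz :: v) (z * a) = coef v a.
Proof.
rewrite /coef -[z]/(letterA gz) pairing_letter => hv; congr (pairing _ a).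
apply/funext => w; rewrite /act.
by case: w => [|[] [|[] w]] //=; case: v hv => [|[] v].
Qed.

(** A word v of a that does not start with x keeps its coefficient, at uv in ua = 0. The kernel of x
    is found in the same way. *)
Lemma lker_u a : (x + y) * a = 0 -> exists b, a = x * b.
Proof.
move=> ua0; apply: (@coef_ind (fun c => exists b, c = x * b) a).
- by exists 0; rewrite mulr0.
- by move=> _ _ [b ->] [c ->]; exists (b + c); rewrite mulrDr.
- by move=> t _ [b ->]; exists (t *: b); rewrite scalerAr.
move=> v nv; have [hv|hv] := eqVneq (head gz v) gx.
  by move=> _; case: v hv {nv} => // _ v /= ->; exists (wordA v); rewrite wordA_cons.
by rewrite -coef_mul_u // ua0 raddf0 eqxx.
Qed.

Lemma lker_x a : x * a = 0 -> exists b, a = z * b.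
Proof.
move=> xa0; apply: (@coef_ind (fun c => exists b, c = z * b) a).
- by exists 0; rewrite mulr0.
- by move=> _ _ [b ->] [c ->]; exists (b + c); rewrite mulrDr.
- by move=> t _ [b ->]; exists (t *: b); rewrite scalerAr.
move=> v nv; have [hv|hv] := eqVneq (head gx v) gz.
  by move=> _; case: v hv {nv} => // _ v /= ->; exists (wordA v); rewrite wordA_cons.
by rewrite -coef_mul_x // xa0 raddf0 eqxx.
Qed.

(** A word v of a that does not end in x gives vz in az = ub, so vz starts with u, and hence so does
    v. *)
Lemma mulz_eq_mulu a b : (x + y) * b = a * z -> exists c d, a = (x + y) * c + d * x.
Proof.
move=> ub; apply: (@coef_ind (fun a => exists c d, a = (x + y) * c + d * x) a).
- by exists 0, 0; rewrite mulr0 mul0r addr0.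
- move=> _ _ [c [d ->]] [c' [d' ->]]; exists (c + c'), (d + d').
  by rewrite mulrDr (mulrDl d) addrACA.
- move=> t _ [c [d ->]]; exists (t *: c), (t *: d).
  by rewrite scalerDr scalerAr scalerAl.
move=> v nv; have [lv _|lv] := eqVneq (last gz v) gx.
  case/lastP: v lv {nv} => // v g; rewrite last_rcons => ->.
  by exists 0, (wordA v); rewrite wordA_rcons mulr0 add0r.
rewrite -coef_mulr_z ?normal_rcons_z // -ub.
have [hv _|hv] := eqVneq (head gz v) gu.
  case: v hv {nv lv} => // _ v /= ->.
  by exists (wordA v), 0; rewrite wordA_cons mul0r addr0.
by rewrite coef_mul_u0 ?eqxx //; case: v hv {nv lv}.
Qed.

(** The equations ub = az and xc = by are solved in turn: a = u al + be x, then b = x ga + al z,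
    then c = z de + ga y. *)
Lemma cocycle_reduce f : f \in cocycle x y z ->
  exists g b, f = d2 x y z g + (b * x, 0, 0).
Proof.
case: f => [[a b] c] /eqP[/eqP]; rewrite subr_eq0 => /eqP ub.
move=> /eqP; rewrite subr_eq0 => /eqP xc.
have [al [be Ea]] := mulz_eq_mulu ub.
(* As xz = 0, az = u al z; likewise zy = 0 gives by = x ga y below. *)
have [|ga Eb] := @lker_u (b - al * z).
  by rewrite mulrBr ub Ea mulrDl -(mulrA be) xz mulr0 addr0 mulrA subrr.
have {}Eb : b = x * ga + al * z by rewrite -Eb subrK.
have [|de Ec] := @lker_x (c - ga * y).
  by rewrite mulrBr xc Eb mulrDl -(mulrA al) zy mulr0 addr0 mulrA subrr.
have {}Ec : c = z * de + ga * y by rewrite -Ec subrK.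
(* [d2] of this triple has first entry u al + al x + de x and matches b and c exactly. *)
exists (al, de, ga), (be - (al + de)); rewrite Eb Ec Ea.
congr (_, _, _); rewrite /= ?addr0 // mulrBl (mulrDl al).
by rewrite -(addrA ((x + y) * al)) -addrA [X in _ = _ + X]addrC subrK.
Qed.

Lemma coef_coboundary v g :  normal v -> head gz v = gz -> last gz v = gz ->
  forall b, (b * x, 0, 0) = d2 x y z g -> coef v b = 0.
Proof.
case: g => [[al be] ga] nv hv lv b [Ef Eg Eh].
have nvx : normal (rcons v gx) by apply: normal_rcons_x.
have nvz : normal (rcons v gz) by apply: normal_rcons_z; rewrite ?lv.
(* Compare al z = - x ga at vz, which does not start with x. *)
have E1 : coef v al = 0.
  have /esym/eqP := Eg; rewrite addr_eq0 => /eqP xga.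
  rewrite -coef_mulr_z // -[al * z]opprK raddfN /= -xga coef_mul_x0 ?oppr0 //.
  by case: (v) hv => // h w /= ->.
(* Compare z be = - ga y at zv, which ends in z. *)
have E2 : coef v be = 0.
  have /esym/eqP := Eh; rewrite addr_eq0 => /eqP zbe.
  rewrite -coef_mul_z // zbe raddfN /=.
  case/lastP: (v) lv => [_|w h]; first by rewrite (@coef_rcons_z_mul_y [::]) oppr0.
  by rewrite last_rcons => ->; rewrite -rcons_cons coef_rcons_z_mul_y oppr0.
(* Compare bx = u al + al x + be x at vx, which does not start with u. *)
rewrite -coef_mulr_x // Ef !raddfD /= !coef_mulr_x // E1 E2 !addr0 coef_mul_u0 //.
by case: (v) hv => // h w /= ->.
Qed.

End Words.

(** * The words z^m x u^n z^m' ... with positive exponents: nonempty normal words from z to z *)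

Fixpoint zcode (m : nat) (r : seq (nat * nat)) : word :=
  nseq m gz ++ if r is (n, m') :: r' then gx :: nseq n gu ++ zcode m' r' else [::].

Definition pos_pair (nm : nat * nat) : bool := (0 < nm.1)%N && (0 < nm.2)%N.

Lemma head_zcode m r : (0 < m)%N -> head gx (zcode m r) = gz.
Proof. by case: m => // m _; case: r. Qed.

Lemma zcode_normal m r : (0 < m)%N -> all pos_pair r -> normal (zcode m r).
Proof.
elim: r m => [|[n m'] r IH] m m0 /= => [_|/andP[/andP[/= n0 m'0] rp]].
  by case: m {m0} => // m; rewrite cats0; elim: m => // m IH; rewrite /= eqxx; apply: IH.
have {IH}: normal (zcode m' r) by apply: IH.
have := head_zcode r m'0; case: (zcode m' r) => // g w /= -> {g} nw.
have {}nw : normal (nseq n gu ++ gz :: w).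
  case: n {n0} => // n; elim: n => [|n IH]; first by rewrite /= eqxx.
  by rewrite /= eqxx; apply: IH.
case: n n0 nw => // n _ nw.
have {}nw : normal (gx :: nseq n.+1 gu ++ gz :: w) by rewrite /= eqxx.
case: m m0 => // m _; elim: m => [|m IH]; first by rewrite /= eqxx.
by rewrite /= eqxx; apply: IH.
Qed.

Lemma last_zcode m r g : (0 < m)%N -> all pos_pair r -> last g (zcode m r) = gz.
Proof.
elim: r m g => [|[n m'] r IH] m g m0 /= => [_|/andP[/andP[_ m'0] rp]].
  by case: m m0 => // m _; rewrite cats0 /=; elim: m.
by rewrite !last_cat /= last_cat IH.
Qed.

(** The hypotheses say that v and v' do not start with g, so the initial runs of g have equal
    length. *)
Lemma nseq_cat_inj (g : gen) m m' v v' : head g (rcons v g) != g \/ v = [::] ->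
  head g (rcons v' g) != g \/ v' = [::] ->
  nseq m g ++ v = nseq m' g ++ v' -> m = m' /\ v = v'.
Proof.
move=> hv hv'; elim: m m' => [|m IH] [|m'] //=.
- by case: hv => [/[swap] -> | ->] //=; rewrite eqxx.
- by case: hv' => [/[swap] <- | ->] //=; rewrite eqxx.
- by case=> /IH[-> ->].
Qed.

Lemma zcode_inj m m' r r' : (0 < m)%N -> (0 < m')%N -> all pos_pair r -> all pos_pair r' ->
  zcode m r = zcode m' r' -> m = m' /\ r = r'.
Proof.
elim: r m m' r' => [|[n p] r IH] m m' [|[n' p'] r'] m0 m'0 /=.
- by move=> _ _ /nseq_cat_inj[||->]; auto.
- by move=> _ _ /nseq_cat_inj[||]; auto.
- by move=> _ _ /nseq_cat_inj[||]; auto.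
move=> /andP[/andP[/= n0 p0] rp] /andP[/andP[/= n'0 p'0] rp'] /nseq_cat_inj[||-> []]; auto.
have hz q s : (0 < q)%N -> head gu (rcons (zcode q s) gu) != gu \/ zcode q s = [::].
  by move=> /(head_zcode s); case: zcode => // g w /= ->; left.
case/nseq_cat_inj; [exact: hz|exact: hz|move=> -> /IH[]] => //.
by move=> -> ->.
Qed.

(** Reading from the left, z is followed by z or x, u by u or z, and an x that comes after z by u,
    since xz and zxx are excluded. The cases on the first letter make this an induction; for a first
    letter x the condition asks that z may be put before it. *)
Lemma normal_zcode w : normal w -> last gx w = gz ->
  match w with
  | [::] => False
  | gz :: _ => exists m r, [/\ (0 < m)%N, all pos_pair r & w = zcode m r]
  | gu :: _ => exists n m r,
      [/\ (0 < n)%N, (0 < m)%N, all pos_pair r & w = nseq n gu ++ zcode m r]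
  | gx :: w' => lmulw gz w = Some (gz :: w) -> exists n m r,
      [/\ (0 < n)%N, (0 < m)%N, all pos_pair r & w' = nseq n gu ++ zcode m r]
  end.
Proof.
elim: w => // g w IH /= /andP[ng nw].
case: w IH ng nw => [|h w] IH ng nw lw; first by case: g lw {ng} => //= _; exists 1%N, [::].
move/(_ nw lw): IH => {nw lw}.
case: g ng => //; case: h => //.
- by move=> _ [n [m [r [n0 m0 rp ->]]]]; exists n.+1, m, r.
- by move=> _ [m [r [m0 rp ->]]]; exists 1%N, m, r.
- move=> /eqP ng /(_ ng)[n [m [r [n0 m0 rp ->]]]].
  by exists 1%N, ((n, m) :: r); rewrite /= /pos_pair n0 m0 rp.
- by case: w => [|[]].
- move=> _ [m [r [m0 rp ->]]]; exists m.+1, r; split=> //.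
  by case: r {rp}.
Qed.

(** * The index set of the basis as a set of words *)

Definition index_word (i : option Bindex) : word :=
  if i is Some nm
  then zcode (head 0%N (val nm).2) (zip (val nm).1 (behead (val nm).2)) else [::].

Lemma all_pos_zip ns ms : all (ltn 0) ns -> all (ltn 0) ms -> all pos_pair (zip ns ms).
Proof.
elim: ns ms => [|n ns IH] [|m ms] //= /andP[n0 nsp] /andP[m0 msp].
by rewrite /pos_pair n0 m0 IH.
Qed.

Lemma index_wordP (nm : Bindex) : exists m r, [/\ (0 < m)%N, all pos_pair r,
  index_word (Some nm) = zcode m r, zip (val nm).1 (behead (val nm).2) = r &
  val nm = (unzip1 r, m :: unzip2 r)].
Proof.
case: nm => -[ns ms] P /=; case/and3P: P => /=.
case: ms => //= m ms; rewrite eqSS => /eqP szms nsp /andP[m0 msp].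
exists m, (zip ns ms); split=> //; first exact: all_pos_zip.
by rewrite unzip1_zip ?unzip2_zip // szms.
Qed.

Lemma index_word_inj : injective index_word.
Proof.
have ne nm : index_word (Some nm) <> [::].
  by case: (index_wordP nm) => m [r [m0 _ -> _ _]]; case: m m0 => // m _; case: r.
case=> [nm|] [nm'|] // E; last 2 first.
- by case: (ne nm).
- by case: (ne nm').
move: E; case: (index_wordP nm) => m [r [m0 rp -> _ E1]].
case: (index_wordP nm') => m' [r' [m'0 rp' -> _ E2]] /zcode_inj[] // Em Er.
by congr Some; apply: val_inj; rewrite E1 E2 Em Er.
Qed.

Lemma index_word_normal i : normal (index_word i).
Proof.
by case: i => // nm; case: (index_wordP nm) => m [r [m0 rp -> _ _]]; apply: zcode_normal.
Qed.

Lemma head_index_word i : head gz (index_word i) = gz.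
Proof.
case: i => // nm; case: (index_wordP nm) => m [r [m0 _ -> _ _]].
by have := head_zcode r m0; case: zcode.
Qed.

Lemma last_index_word i : last gz (index_word i) = gz.
Proof.
by case: i => // nm; case: (index_wordP nm) => m [r [m0 rp -> _ _]]; apply: last_zcode.
Qed.

Lemma index_word_surj w :
  normal w -> head gz w = gz -> last gz w = gz -> exists i, w = index_word i.
Proof.
case: w => [|g w] nw hw lw; first by exists None.
move: (normal_zcode nw lw); rewrite /= in hw; rewrite hw => -[m [r [m0 rp ->]]].
have P : [&& size (m :: unzip2 r) == (size (unzip1 r)).+1, all (ltn 0) (unzip1 r)
            & all (ltn 0) (m :: unzip2 r)].
  rewrite /= !size_map eqxx m0 /= !all_map -all_predI.
  by apply: sub_all rp => nm /andP[n0 n1] /=; rewrite n0 n1.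
exists (Some (exist _ (unzip1 r, m :: unzip2 r) P)).
by rewrite /= zip_unzip.
Qed.

(** [spanning] asks for one coefficient per index, while the sums built below are lists of pairs
    with possible repetitions. *)
Lemma sum_pairs_undup (k : fieldType) (V : lmodType k) (I : eqType) (e : I -> V)
    (ts : seq (k * I)) :
  \sum_(t <- ts) t.1 *: e t.2 =
  \sum_(i <- undup [seq t.2 | t <- ts]) (\sum_(t <- ts | t.2 == i) t.1) *: e i.
Proof.
under [RHS]eq_bigr do rewrite scaler_suml.
rewrite (exchange_big_dep xpredT) //= big_seq [RHS]big_seq; apply: eq_bigr => t tts.
rewrite (eq_bigl (pred1 t.2)) => [|i]; last by rewrite /= eq_sym.
by rewrite -big_filter filter_pred1_uniq ?undup_uniq ?mem_undup ?map_f // big_seq1.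
Qed.

(** * From words in u back to the products in y *)

Section Index.
Variables (k : fieldType) (B : algType k) (x y z : B).
Hypotheses (xx : x ^+ 2 + y * x = 0) (xz : x * z = 0) (zy : z * y = 0).

(** Each new factor u = x + y contributes only y, because z x u^n x = 0: by zxx = 0 for n = 0, and
    by ux = 0 otherwise. *)
Lemma zxu_exp n : z * x * (x + y) ^+ n = z * x * y ^+ n.
Proof.
elim: n => // n IH; rewrite !exprSr !mulrA -IH mulrDr [X in X + _ = _](_ : _ = 0) ?add0r //.
case: n {IH} => [|n]; first by rewrite expr0 mulr1 (zxx xx zy).
by rewrite exprSr -!mulrA (ux xx) !mulr0.
Qed.

Lemma wordA_nseq n g : wordA x y z (nseq n g) = letterA x y z g ^+ n.
Proof. by rewrite /wordA big_nseq; elim: n => // n IH; rewrite iterS IH exprS. Qed.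

Lemma wordA_zcode m r : (0 < m)%N -> all pos_pair r ->
  wordA x y z (zcode m r) = z ^+ m * \prod_(nm <- r) (x * y ^+ nm.1 * z ^+ nm.2).
Proof.
elim: r m => [|[n m'] r IH] m m0 /=.
  by rewrite cats0 wordA_nseq big_nil mulr1.
case/andP=> /andP[_ m'0] rp; rewrite wordA_cat wordA_cons wordA_cat !wordA_nseq IH //.
(* One z is split off z^m, to stand in front of x u^n. *)
rewrite big_cons /=; case: m m0 => // m _; rewrite exprSr -!mulrA; congr (_ * _).
by rewrite !mulrA zxu_exp.
Qed.

Lemma wordA_index_word i : wordA x y z (index_word i) =
  if i is Some nm then zword x y z (val nm).1 (val nm).2 else 1.
Proof.
case: i => [nm|]; last by rewrite /wordA big_nil.
case: (index_wordP nm) => m [r [m0 rp -> Er Enm]].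
by rewrite wordA_zcode // /zword Er Enm.
Qed.

End Index.

(** * Cocycles (bx, 0, 0) modulo coboundaries *)

Section Classes.
Variables (k : fieldType) (B : algType k) (x y z : B).
Hypotheses (xx : x ^+ 2 + y * x = 0) (xz : x * z = 0) (zy : z * y = 0).
Hypothesis B_ind : forall P : B -> Prop,
  (forall a b, P a -> P b -> P (a + b)) -> (forall t a, P a -> P (t *: a)) ->
  P 1 -> (forall g a, P a -> P (letterA x y z g * a)) -> forall a, P a.
Variable pairing : (word -> k) -> {scalar B}.
Hypothesis pairing1 : forall phi, pairing phi 1 = phi [::].
Hypothesis pairing_letter : forall phi g a,
  pairing phi (letterA x y z g * a) = pairing (act g phi) a.

Definition xcocycle (b : B) : B * B * B := (b * x, 0, 0).

Lemma xcocycle_is_linear : linear xcocycle.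
Proof.
move=> t a b; rewrite /xcocycle mulrDl -scalerAl.
by congr (_, _, _); rewrite /= scaler0 addr0.
Qed.

HB.instance Definition _ :=
  GRing.isLinear.Build k B (B * B * B)%type *:%R xcocycle xcocycle_is_linear.

Lemma xcocycle_cocycle b : xcocycle b \in cocycle x y z.
Proof.
rewrite /xcocycle; apply/eqP; congr (_, _) => /=.
  by rewrite mulr0 -mulrA xz mulr0 subrr.
by rewrite mulr0 mul0r subrr.
Qed.

(** The component - vz cancels xvz in the entry of xz; ux = 0 and zy = 0 remove the rest. *)
Lemma xcocycle_mul_x v : xcocycle (x * v) = d2 x y z (x * v, 0, - (v * z)).
Proof.
rewrite /xcocycle; congr (_, _, _) => /=.
- by rewrite mulrA (ux xx) !mul0r add0r addr0.
- by rewrite mulrN mulrA addNr.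
- by rewrite mulr0 add0r mulNr -mulrA zy mulr0 oppr0.
Qed.

Lemma xcocycle_mul_y v : xcocycle (y * v) = d2 x y z (0, y * v, 0).
Proof.
by rewrite /xcocycle; congr (_, _, _); rewrite /= ?(mulr0, mul0r, add0r) // mulrA zy mul0r !addr0.
Qed.

(** Up to sign and a coboundary, a final x is traded for an initial u. *)
Lemma xcocycle_mulr_x v :
  xcocycle (v * x) = d2 x y z (v * x, 0, 0) - xcocycle ((x + y) * v).
Proof.
rewrite /xcocycle; congr (_, _, _) => /=.
- by rewrite mul0r addr0 mulrA addrAC subrr add0r.
- by rewrite mulr0 add0r -mulrA xz mulr0 subrr.
- by rewrite mulr0 mul0r addr0 subrr.
Qed.

(** By linearity b is a normal word. A first letter x or u, or a last letter x, gives a coboundary;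
    the words that remain run from z to z or are empty. *)
Lemma xcocycle_span b : exists g (ts : seq (k * option Bindex)),
  xcocycle b = d2 x y z g + \sum_(t <- ts) t.1 *: xcocycle (wordA x y z (index_word t.2)).
Proof.
have cob c : (exists g, xcocycle c = d2 x y z g) -> exists g (ts : seq (k * option Bindex)),
    xcocycle c = d2 x y z g +
      \sum_(t <- ts) t.1 *: xcocycle (wordA x y z (index_word t.2)).
  by move=> [g ->]; exists g, [::]; rewrite big_nil addr0.
have dD : {morph d2 x y z : f f' / f + f'} := raddfD _.
have dZ t : {morph d2 x y z : f / t *: f} := linearZ_LR _ t.
have dB : {morph d2 x y z : f f' / f - f'} := raddfB _.
have xD : {morph xcocycle : f f' / f + f'} := raddfD _.
have xZ t : {morph xcocycle : f / t *: f} := linearZ_LR _ t.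
have ucob v : exists g, xcocycle ((x + y) * v) = d2 x y z g.
  exists ((x * v, 0, - (v * z)) + (0, y * v, 0)).
  by rewrite mulrDl xD dD xcocycle_mul_x xcocycle_mul_y.
elim/(normal_ind xx xz zy B_ind pairing1 pairing_letter): b
    => [|b c [g [ts Eb]] [g' [ts' Ec]]|t b [g [ts Eb]]|w nw].
- by apply: cob; exists 0; rewrite !raddf0.
- by exists (g + g'), (ts ++ ts'); rewrite xD Eb Ec dD big_cat /= addrACA.
- exists (t *: g), [seq (t * p.1, p.2) | p <- ts].
  rewrite xZ Eb dZ big_map scalerDr scaler_sumr.
  by congr (_ + _); apply: eq_bigr => p _; rewrite scalerA.
have [hw|hw] := eqVneq (head gz w) gx.
  case: w hw {nw} => //= _ v ->; apply: cob; rewrite wordA_cons.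
  by eexists; apply: xcocycle_mul_x.
have [hw'|hw'] := eqVneq (head gz w) gu.
  by case: w hw' {nw hw} => //= _ v ->; apply: cob; rewrite wordA_cons; apply: ucob.
have {hw'}hw : head gz w = gz by case: head hw hw'.
have [lw|lw] := eqVneq (last gz w) gx.
  case/lastP: w lw {nw hw} => // v g; rewrite last_rcons => ->.
  apply: cob; rewrite wordA_rcons; case: (ucob (wordA x y z v)) => f Ef.
  by exists ((wordA x y z v * x, 0, 0) - f); rewrite dB -Ef -xcocycle_mulr_x.
have [lw'|lw'] := eqVneq (last gz w) gu.
  case/lastP: w lw' {nw hw lw} => // v g; rewrite last_rcons => ->.
  (* As ux = 0, the cochain itself vanishes when the word ends in u. *)
  apply: cob; exists 0; rewrite raddf0 wordA_rcons /xcocycle -mulrA.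
  by rewrite -[letterA _ _ _ _]/(x + y) (ux xx) mulr0.
have {lw'}lw : last gz w = gz by case: last lw lw'.
have [i ->] := index_word_surj nw hw lw.
by exists 0, [:: (1, i)]; rewrite big_seq1 scale1r raddf0 add0r.
Qed.

(** [c i] is the coefficient at [index_word i], where a coboundary has none by [coef_coboundary]. *)
Lemma xcocycle_indep (s : seq (option Bindex)) (c : option Bindex -> k) g : uniq s ->
  \sum_(i <- s) c i *: xcocycle (wordA x y z (index_word i)) = d2 x y z g ->
  forall i, i \in s -> c i = 0.
Proof.
move=> us Es i si.
have E : xcocycle (\sum_(i <- s) c i *: wordA x y z (index_word i)) = d2 x y z g.
  rewrite raddf_sum -Es; apply: eq_bigr => j _; exact: linearZ_LR.
have := coef_coboundary xx xz zy B_ind pairing1 pairing_letter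
  (index_word_normal i) (head_index_word i) (last_index_word i) E.
have cE := coef_wordA pairing1 pairing_letter.
rewrite raddf_sum (bigD1_seq i) //= linearZ /= cE ?index_word_normal // eqxx mulr1.
rewrite big1 ?addr0 // => j /negPf ji.
by rewrite linearZ /= cE ?index_word_normal // (inj_eq index_word_inj) ji mulr0.
Qed.

End Classes.

(** * Specialisation to A and the basis of its cohomology *)

Lemma letterA_ind (k : fieldType) (P : A k -> Prop) :
  (forall a b, P a -> P b -> P (a + b)) -> (forall t a, P a -> P (t *: a)) ->
  P 1 -> (forall g a, P a -> P (letterA (Ax k) (Ay k) (Az k) g * a)) -> forall a, P a.
Proof.
move=> PD PZ P1 Pg; apply: A_ind => // a Pa; last exact: (Pg gz).
  exact: (Pg gx).
have -> : Ay k * a = (Ax k + Ay k) * a + (-1) *: (Ax k * a).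
  by rewrite mulrDl scaleN1r addrAC subrr add0r.
by apply: PD; [exact: (Pg gu) | apply: PZ; exact: (Pg gx)].
Qed.

Lemma pair_letter (k : fieldType) phi g (a : A k) :
  pair phi (letterA (Ax k) (Ay k) (Az k) g * a) = pair (act g phi) a.
Proof.
case: g; [exact: pair_mulX | | exact: pair_mulZ].
by rewrite /= mulrDl raddfD /= pair_mulX pair_mulY addrC subrK.
Qed.

Theorem proposition3p7 (k : fieldType) (char0 : [pchar k]%R =i pred0) :
  exists e : option Bindex -> Z2 k,
    (forall i : option Bindex, val (e i) = HH2_rep k i) /\
    is_basis (fun i : option Bindex => HH2_class (e i)).
Proof.
have xx := Axx k; have xz := Axz k; have zy := Azy k.
(* The representatives are first given by words in u; [wordA_index_word] identifies them with those
   in y. *)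
pose e i : Z2 k := exist _ (xcocycle (Ax k) (wordA (Ax k) (Ay k) (Az k) (index_word i)))
  (xcocycle_cocycle (Ay k) xz _).
have classE (f f' : Z2 k) : reflect (exists g, val f = d2 (Ax k) (Ay k) (Az k) g + val f')
    (HH2_class f == HH2_class f').
  rewrite /HH2_class /cclass lproj_eq; apply: (iffP (asboolP _)) => -[g Eg]; exists g.
    by rewrite -Eg subrK.
  by rewrite raddfB /= Eg addrK.
(* [h] will be the identity for independence and the second projection for spanning. *)
have sumE (I : Type) (s : seq I) (c : I -> k) (h : I -> option Bindex) :
    \sum_(i <- s) c i *: HH2_class (e (h i)) =
    HH2_class (\sum_(i <- s) c i *: e (h i)).
  by rewrite raddf_sum; apply: eq_bigr => i _; symmetry; apply: linearZ_LR.
have valE (I : Type) (s : seq I) (c : I -> k) (h : I -> option Bindex) :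
    val (\sum_(i <- s) c i *: e (h i)) =
    \sum_(i <- s) c i *: xcocycle (Ax k) (wordA (Ax k) (Ay k) (Az k) (index_word (h i))).
  by rewrite raddf_sum; apply: eq_bigr => i _; apply: linearZ_LR.
exists e; split; last split.
- move=> i; rewrite [val _]/(xcocycle _ _) /xcocycle (wordA_index_word xx zy).
  by case: i => // ; rewrite mul1r.
- move=> s c us; rewrite (sumE _ s c id) => /eqP.
  rewrite -(raddf0 (@HH2_class k)) => /classE[g]; rewrite (valE _ s c id) addr0.
  exact: (xcocycle_indep xx xz zy (@letterA_ind k) (@pair1 k) (@pair_letter k) us).
- move=> q; pose f : Z2 k := repr q.
  have [g [b Ef]] := cocycle_reduce xx xz zy (@letterA_ind k) (@pair1 k) (@pair_letter k) (valP f).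
  have [g' [ts Eb]] := xcocycle_span xx xz zy (@letterA_ind k) (@pair1 k) (@pair_letter k) b.
  exists (undup [seq t.2 | t <- ts]), (fun i => \sum_(t <- ts | t.2 == i) t.1).
  rewrite -(sum_pairs_undup (fun i => HH2_class (e i))) (sumE _ ts fst snd).
  (* g comes from reducing the cocycle to (bx, 0, 0), g' from reducing b. *)
  rewrite -[q]lproj_repr; apply/eqP/classE; exists (g + g').
  by rewrite valE [LHS]Ef [X in _ + X = _]Eb addrA raddfD.
Qed.
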